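(* Let $\Gamma\subseteq\mathbb{R}^d$ be a $d$-dimensional lattice, and let $f(m)$ denote the number of distinct (ordinary) coincidence site lattices of $\Gamma$ of index $m$. The following statements are equivalent: (i) $f$ is multiplicative, i.e. $f(mn)=f(m)f(n)$ for all coprime positive integers $m,n$. (ii) Every (ordinary) CSL $\Gamma(R)$ of $\Gamma$ can be written (uniquely) as $\Gamma(R)=\Gamma(R_1)\cap\ldots\cap\Gamma(R_n)$, where $R_1,\ldots,R_n$ are coincidence isometries of $\Gamma$ whose indices $\Sigma(R_i)$ are powers of distinct primes. (iii) For every $n\geq 1$, every MCSL $\Gamma(R_1,\ldots,R_n)$ of order $n$ of $\Gamma$ can be written (uniquely) as $\Gamma(R_1,\ldots,R_n)=\Gamma_1\cap\ldots\cap\Gamma_k$, where $\Gamma_1,\ldots,\Gamma_k$ are MCSLs of $\Gamma$ of order at most $n$ whose indices $[\Gamma:\Gamma_j]$, $j=1,\dots,k$, are powers of distinct primes.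
   Context: Let $\Gamma\subseteq\mathbb{R}^d$ be a lattice of full rank $d$. A linear isometry $R\in\mathrm{O}(d)$ is a coincidence isometry of $\Gamma$ if $\Gamma(R):=\Gamma\cap R\Gamma$ has finite index in $\Gamma$; then $\Gamma(R)$ is called an (ordinary) coincidence site lattice (CSL) of $\Gamma$, with index $\Sigma(R):=[\Gamma:\Gamma(R)]$. For $m\in\mathbb{N}=\{1,2,\dots\}$, $f(m)$ is the number of distinct sublattices of the form $\Gamma(R)$ with $R$ a coincidence isometry and $\Sigma(R)=m$. For coincidence isometries $R_1,\dots,R_n$ of $\Gamma$, the lattice $\Gamma(R_1,\ldots,R_n):=\Gamma\cap R_1\Gamma\cap\ldots\cap R_n\Gamma=\Gamma(R_1)\cap\ldots\cap\Gamma(R_n)$ is called a multiple CSL (MCSL) of order $n$ of $\Gamma$; its index is its index in $\Gamma$. In (ii) the number of lattices in the decomposition may depend on $\Gamma(R)$, and in (iii) $k$ may depend on the MCSL. Powers of primes include $p^0=1$ (so the lattice $\Gamma$ itself, of index $1$, is trivially decomposed). Uniqueness refers to the lattices occurring in the intersection (not to the isometries generating them), up to permutation and up to inserting or omitting trivial constituents equal to $\Gamma$. *)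

(* Defs.v *)
From mathcomp Require Import all_boot all_order all_algebra finmap.
From mathcomp Require Import boolp classical_sets functions cardinality reals.

Set Implicit Arguments.
Unset Strict Implicit.
Unset Printing Implicit Defensive.

Import GRing.Theory.

Local Open Scope classical_set_scope.
Local Open Scope ring_scope.

Definition is_lattice (R : realType) (d : nat) (G : set 'cV[R]_d) : Prop :=
  exists2 B : 'M[R]_d, B \in unitmx &
    G = range (fun z : 'cV[int]_d => B *m map_mx intr z).

Definition orthogonal_mx (R : realType) (d : nat) (A : 'M[R]_d) : Prop :=
  A^T *m A = 1%:M.

Definition cosets (V : zmodType) (G L : set V) : set (set V) :=
  [set [set x + y | y in L] | x in G].

Definition finite_index (V : zmodType) (G L : set V) : Prop :=
  finite_set (cosets G L).

(* By the convention of fset_set, the value is 0 when the index is infinite. *)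
Definition sub_index (V : zmodType) (G L : set V) : nat :=
  #|` fset_set (cosets G L)|%fset.

Definition csl (R : realType) (d : nat) (G : set 'cV[R]_d) (A : 'M[R]_d) :
    set 'cV[R]_d :=
  G `&` (mulmx A @` G).

Definition coincidence_isometry (R : realType) (d : nat) (G : set 'cV[R]_d)
    (A : 'M[R]_d) : Prop :=
  orthogonal_mx A /\ finite_index G (csl G A).

Definition csls_of_index (R : realType) (d : nat) (G : set 'cV[R]_d)
    (m : nat) : set (set 'cV[R]_d) :=
  [set L | exists A : 'M[R]_d,
    [/\ coincidence_isometry G A, L = csl G A & sub_index G L = m]].

(* For m > 0 and G a lattice this set is finite, since G has only finitely many
   subgroups of index m; the cardinality below is then the genuine one. *)
Definition csl_count (R : realType) (d : nat) (G : set 'cV[R]_d)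
    (m : nat) : nat :=
  #|` fset_set (csls_of_index G m)|%fset.

Definition multiplicative (f : nat -> nat) : Prop :=
  forall m n : nat, (0 < m)%N -> (0 < n)%N -> coprime m n ->
    f (m * n)%N = (f m * f n)%N.

Definition mcsl (R : realType) (d : nat) (G : set 'cV[R]_d) (n : nat)
    (A : 'I_n -> 'M[R]_d) : set 'cV[R]_d :=
  G `&` \bigcap_i (mulmx (A i) @` G).

Definition is_mcsl (R : realType) (d : nat) (G : set 'cV[R]_d) (n : nat)
    (L : set 'cV[R]_d) : Prop :=
  (0 < n)%N /\
  exists2 A : 'I_n -> 'M[R]_d,
    (forall i, coincidence_isometry G (A i)) & L = mcsl G A.

(* Exponents may be 0, so constituents equal to G are allowed; in particular
   requiring k > 0 excludes nothing but the empty intersection. *)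
Definition prime_power_decomposition (V : zmodType) (G L : set V) (k : nat)
    (M : 'I_k -> set V) : Prop :=
  [/\ (0 < k)%N,
      L = \bigcap_i M i &
      exists p a : 'I_k -> nat,
        injective p /\
        forall i, prime (p i) /\ sub_index G (M i) = (p i ^ a i)%N].

(* Equality of two families up to permutation and up to inserting or omitting
   members equal to G. *)
Definition same_constituents (V : zmodType) (G : set V) (k k' : nat)
    (M : 'I_k -> set V) (M' : 'I_k' -> set V) : Prop :=
  perm_eq [seq N <- codom M | N != G] [seq N <- codom M' | N != G].

Definition csl_decomposition (R : realType) (d : nat) (G L : set 'cV[R]_d)
    (k : nat) (A : 'I_k -> 'M[R]_d) : Prop :=
  (forall i, coincidence_isometry G (A i)) /\
  prime_power_decomposition G L (fun i => csl G (A i)).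

Definition mcsl_decomposition (R : realType) (d : nat) (G L : set 'cV[R]_d)
    (n k : nat) (M : 'I_k -> set 'cV[R]_d) : Prop :=
  (forall j, exists2 q : nat, (q <= n)%N & is_mcsl G q (M j)) /\
  prime_power_decomposition G L M.

Definition csls_decompose_uniquely (R : realType) (d : nat)
    (G : set 'cV[R]_d) : Prop :=
  forall A : 'M[R]_d, coincidence_isometry G A ->
    (exists (k : nat) (B : 'I_k -> 'M[R]_d),
       csl_decomposition G (csl G A) B) /\
    (forall (k k' : nat) (B : 'I_k -> 'M[R]_d) (B' : 'I_k' -> 'M[R]_d),
       csl_decomposition G (csl G A) B ->
       csl_decomposition G (csl G A) B' ->
       same_constituents G (fun i => csl G (B i)) (fun i => csl G (B' i))).

Definition mcsls_decompose_uniquely (R : realType) (d : nat)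
    (G : set 'cV[R]_d) : Prop :=
  forall (n : nat) (L : set 'cV[R]_d), (1 <= n)%N -> is_mcsl G n L ->
    (exists (k : nat) (M : 'I_k -> set 'cV[R]_d),
       mcsl_decomposition G L n M) /\
    (forall (k k' : nat) (M : 'I_k -> set 'cV[R]_d)
        (M' : 'I_k' -> set 'cV[R]_d),
       mcsl_decomposition G L n M ->
       mcsl_decomposition G L n M' ->
       same_constituents G M M').

(* Main.v *)
(* The p-primary part of a finite index sublattice L of G is
   {x in G | n x in L for some n prime to p}.  If L is an intersection of
   lattices whose indices are powers of distinct primes, those lattices are
   primary parts of L; hence uniqueness.  As primary parts commute with
   intersections, (ii) and (iii) both say that primary parts of CSLs are CSLs.

   For (i), choose for each CSL C an isometry R_C with C = Gamma(R_C).  When the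
   indices m, n of C and D are coprime, Gamma(R_C R_D) = C :&: R_C D has index
   m n, and (C, D) |-> Gamma(R_C R_D) is injective; hence f(m) f(n) <= f(m n),
   and equality forces every CSL of index m n to lie in a CSL of index m.
   Conversely, if every CSL of index m n is of the form C :&: D, counting these
   pairs gives equality, and then all such C :&: D are CSLs; by induction on the
   index, a sublattice all of whose primary parts are CSLs is then a CSL. *)
Require Import Defs.
From HB Require Import structures.
From mathcomp Require Import all_boot all_order all_algebra finmap.
From mathcomp Require Import boolp classical_sets functions cardinality reals.

Set Implicit Arguments.
Unset Strict Implicit.
Unset Printing Implicit Defensive.

Import GRing.Theory Num.Theory.
(* GRing.Theory shadows [multiplicative]. *)
Import Defs.

Local Open Scope classical_set_scope.
Local Open Scope ring_scope.
Local Open Scope card_scope.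

(** [f] factors through [h] on [A]: the map [s] picks a preimage under [h], and [f \o s] carries the
    image of [h] onto that of [f]. This lets cosets be counted through any map that separates
    them. *)
Lemma card_le_image_fiber (T U W : Type) (A : set T) (f : T -> U) (h : T -> W) :
  {in A &, forall x y, h x = h y -> f x = f y} -> f @` A #<= h @` A.
Proof.
move=> fh; have [->|/set0P[x0 Ax0]] := eqVneq A set0.
  by rewrite !image_set0 card_ge0.
pose s w := if pselect (exists2 x, A x & h x = w) is left e
            then projT1 (cid2 e) else x0.
have -> : f @` A = (f \o s) @` (h @` A).
  rewrite image_comp; apply: eq_imagel => x Ax /=.
  rewrite /s; case: pselect => [e|[]]; last by exists x.
  by case: cid2 => y Ay hy /=; apply: fh; rewrite ?inE.
exact: card_image_le.
Qed.

(** * Subgroups and indices *)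

Definition subgroup (V : zmodType) (G : set V) : Prop :=
  G 0 /\ forall x y, G x -> G y -> G (x - y).

(** Finiteness is recorded besides the value, since [sub_index] has a default value at infinite
    index. *)
Definition has_index (V : zmodType) (G L : set V) (n : nat) : Prop :=
  finite_index G L /\ sub_index G L = n.

Section Cosets.
Context {V : zmodType}.
Implicit Types (G L M : set V) (x y : V).

Lemma subgroup0 G : subgroup G -> G 0.
Proof. by case. Qed.

Lemma subgroupB G x y : subgroup G -> G x -> G y -> G (x - y).
Proof. by move=> [_]; apply. Qed.

Lemma subgroupN G x : subgroup G -> G x -> G (- x).
Proof. by move=> sG Gx; rewrite -sub0r; apply: subgroupB => //; case: sG. Qed.

Lemma subgroupD G x y : subgroup G -> G x -> G y -> G (x + y).
Proof.
by move=> sG Gx Gy; rewrite -(opprK y); apply: subgroupB => //; apply: subgroupN.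
Qed.

Lemma subgroupMn G x n : subgroup G -> G x -> G (x *+ n).
Proof.
move=> sG Gx; elim: n => [|n IH]; first by rewrite mulr0n; case: sG.
by rewrite mulrS; apply: subgroupD.
Qed.

Lemma subgroup_image (W : zmodType) (f : {additive V -> W}) G :
  subgroup G -> subgroup (f @` G).
Proof.
move=> sG; split; first by exists 0; rewrite ?raddf0//; apply: subgroup0.
move=> _ _ [x Gx <-] [y Gy <-].
by exists (x - y); rewrite ?raddfB//; apply: subgroupB.
Qed.

Lemma subgroup_muln G n : subgroup G -> subgroup [set x *+ n | x in G].
Proof.
move=> sG; split; first by exists 0; rewrite ?mul0rn//; apply: subgroup0.
move=> _ _ [x Gx <-] [y Gy <-].
by exists (x - y); rewrite ?mulrnBl//; apply: subgroupB.
Qed.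

Lemma subgroupI G L : subgroup G -> subgroup L -> subgroup (G `&` L).
Proof.
move=> sG sL; split; first by split; [case: sG | case: sL].
by move=> x y [Gx Lx] [Gy Ly]; split; apply: subgroupB.
Qed.

Lemma subgroup_subl G x y : subgroup G -> G (x - y) -> G y -> G x.
Proof. by move=> sG Gxy Gy; rewrite -(subrK y x); apply: subgroupD. Qed.

(** By Bezout, [x] is the difference of a multiple of [x *+ m] and a multiple of [x *+ n]. *)
Lemma subgroup_coprime G x m n : subgroup G -> coprime m n ->
  G (x *+ m) -> G (x *+ n) -> G x.
Proof.
move=> sG; have [->|m0] := posnP m.
  by rewrite /coprime gcd0n => /eqP ->.
move=> co Gm Gn; case: (egcdnP n m0) => km kn e _.
rewrite (eqP co) in e.
have : G (x *+ (km * m) - x *+ (kn * n)).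
  rewrite mulnC mulrnA (mulnC kn) mulrnA.
  by apply: subgroupB => //; apply: subgroupMn.
by rewrite e mulrnDr addrAC subrr add0r.
Qed.

Lemma coset_eqP L x y : subgroup L ->
  [set x + z | z in L] = [set y + z | z in L] <-> L (x - y).
Proof.
move=> sL; split=> [e|Lxy].
  have : [set x + z | z in L] x by exists 0; rewrite ?addr0//; case: sL.
  by rewrite e => -[z Lz <-]; rewrite addrC addKr.
apply/seteqP; split=> _ [z Lz <-].
  exists ((x - y) + z); first exact: subgroupD.
  by rewrite addrA (addrC y) subrK.
exists (z - (x - y)); first exact: subgroupB.
by rewrite opprB addrCA (addrC y) addNKr addrC.
Qed.

Lemma has_indexP G L n : has_index G L n <-> cosets G L #= `I_n.
Proof.
split=> [[fin <-]|c].
  rewrite -[X in X #= _](fset_setK fin); exact/card_eq_fsetP.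
split; last exact: card_fset_set.
by apply/finite_setP; exists n.
Qed.

Lemma cosets_card G L (T : Type) (g : V -> T) : subgroup L ->
  (forall x y, G x -> G y -> g x = g y <-> L (x - y)) ->
  cosets G L #= g @` G.
Proof.
move=> sL H; rewrite card_eq_le; apply/andP; split;
  apply: card_le_image_fiber => x y /[!inE] Gx Gy.
  by move=> /H - /(_ Gx Gy) /(coset_eqP _ _ sL).
by move=> /(coset_eqP _ _ sL) /H; apply.
Qed.

End Cosets.

(** * Index arithmetic: towers, intersections, orders of elements *)

Section Index.
Context {V : zmodType}.
Implicit Types (G L M : set V) (x y : V).

Lemma card_setT_finType (T : finType) : [set: T] #= `I_#|T|.
Proof.
rewrite (card_eqr card_II).
suff -> : [set: 'I_#|T|] = enum_rank @` [set: T].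
  by rewrite card_eq_sym; apply: inj_card_eq => ? ? _ _; apply: enum_rank_inj.
by apply/seteqP; split=> // i _; exists (enum_val i); rewrite ?enum_valK.
Qed.

(** An index is computed by exhibiting a finite type that classifies the cosets, which avoids
    quotient groups. *)
Lemma has_index_of_fun G L (T : finType) (g : V -> T) : subgroup L ->
  (forall x y, G x -> G y -> g x = g y <-> L (x - y)) ->
  (forall t, exists2 x, G x & g x = t) -> has_index G L #|T|.
Proof.
move=> sL H surj; apply/has_indexP; rewrite (card_eql (cosets_card sL H)).
suff -> : g @` G = [set: T] by exact: card_setT_finType.
by apply/seteqP; split=> // t _; have [x] := surj t; exists x.
Qed.

Lemma has_index_le G L (T : finType) (g : V -> T) : subgroup L ->
  (forall x y, G x -> G y -> g x = g y -> L (x - y)) ->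
  exists2 n, has_index G L n & (n <= #|T|)%N.
Proof.
move=> sL H.
have le : cosets G L #<= `I_#|T|.
  rewrite -(card_le_eqr (card_setT_finType T)).
  apply: (card_le_trans _ (subset_card_le (@subsetT _ (g @` G)))).
  apply: card_le_image_fiber => x y /[!inE] Gx Gy e.
  by apply/(coset_eqP _ _ sL)/H.
exists (sub_index G L); last exact: geq_card_fset_set.
by split=> //; apply/finite_set_leP; exists #|T|.
Qed.

Lemma has_index_gt0 G L n : G 0 -> has_index G L n -> (0 < n)%N.
Proof.
move=> G0 /has_indexP; case: n => // c.
have: cosets G L [set 0 + y | y in L] by exists 0.
by move: c; rewrite II0 card_eq0 => /eqP ->.
Qed.

Lemma has_index_self G : subgroup G -> has_index G G 1.
Proof.
move=> sG; rewrite -card_unit.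
apply: (@has_index_of_fun _ _ (unit : finType) (fun=> tt)) => //.
  by move=> x y Gx Gy; split=> // _; apply: subgroupB.
by case; exists 0 => //; apply: subgroup0.
Qed.

Lemma has_index_uniq G L m n : has_index G L m -> has_index G L n -> m = n.
Proof. by move=> [_ <-] [_ <-]. Qed.

(** This is the converse of [has_index_of_fun]: an enumeration of the cosets is turned into a map on
    elements. *)
Lemma has_index_classifier G L n : subgroup L -> G 0 -> has_index G L n ->
  exists2 g : V -> 'I_n, forall x y, G x -> G y -> g x = g y <-> L (x - y) &
    forall i, exists2 x, G x & g x = i.
Proof.
move=> sL G0 H; have n0 := has_index_gt0 G0 H.
move/has_indexP/pcard_eqP: H => [f].
pose c x := [set x + z | z in L].
have Gc x : G x -> cosets G L (c x) by move=> Gx; exists x.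
have fc x : G x -> (f (c x) < n)%N.
  by move=> /Gc /(@funS _ _ _ _ f).
have val_g x : G x -> val (insubd (Ordinal n0) (f (c x))) = f (c x).
  by move=> Gx; rewrite val_insubd fc.
(* [insubd] makes the map total; it falls back on its default only for [x] outside [G]. *)
exists (fun x => insubd (Ordinal n0) (f (c x))).
  move=> x y Gx Gy; rewrite -(coset_eqP _ _ sL); split=> [|e]; last first.
    by apply: val_inj; rewrite !val_g// -/(c x) /= /c e.
  move=> /(congr1 val); rewrite !val_g// => /(@inj _ _ _ f).
  by apply; rewrite inE; apply: Gc.
move=> i; have [S [x Gx <-] fS] := @surj _ _ _ _ f i (ltn_ord i).
by exists x => //; apply: val_inj; rewrite val_g.
Qed.

(** With representatives [r] of [G] modulo [M], an element [x] is classified modulo [L] by its class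
    modulo [M] together with the class of [x - r (g x)] modulo [L]. *)
Lemma has_index_trans G M L a b : subgroup G -> subgroup L -> subgroup M ->
  L `<=` M -> M `<=` G ->
  has_index G M a -> has_index M L b -> has_index G L (a * b).
Proof.
move=> sG sL sM LM MG.
move=> /(has_index_classifier sM (subgroup0 sG)) [g gP gS].
move=> /(has_index_classifier sL (subgroup0 sM)) [h hP hS].
have /choice[r rP] : forall i, exists x, G x /\ g x = i.
  by move=> i; have [x] := gS i; exists x.
have rG i : G (r i) by case: (rP i).
have Mr x : G x -> M (x - r (g x)) by move=> Gx; apply/gP => //; case: (rP (g x)).
have sub x y z : (x - z) - (y - z) = x - y by rewrite opprB addrA addrNK.
rewrite -[a]card_ord -[b]card_ord -card_prod.
apply: (@has_index_of_fun _ _ _ (fun x => (g x, h (x - r (g x))))) => //.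
- move=> x y Gx Gy; split=> [[e]|Lxy].
    rewrite e => /hP; rewrite sub; apply; last exact: Mr.
    by rewrite -e; apply: Mr.
  have e : g x = g y by apply/gP => //; apply: LM.
  rewrite e; congr (_, _); apply/hP; rewrite ?sub//; last exact: Mr.
  by rewrite -e; apply: Mr.
- move=> [i j]; have [m Mm <-] := hS j; have [Gr gr] := rP i.
  have e : g (r i + m) = i.
    rewrite -[RHS]gr; apply/gP => //; last by rewrite addrC addKr.
    exact: subgroupD (MG _ Mm).
  exists (r i + m); first exact: subgroupD (MG _ Mm).
  by rewrite e [r i + m]addrC addrK.
Qed.

Lemma has_index_factor G M L n : subgroup G -> subgroup L -> subgroup M ->
  L `<=` M -> M `<=` G -> has_index G L n ->
  exists a b, [/\ has_index G M a, has_index M L b & n = (a * b)%N].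
Proof.
move=> sG sL sM LM MG GL; have [fGL _] := GL.
have fM : finite_index G M.
  apply: (card_le_finite _ fGL); apply: card_le_image_fiber => x y _ _.
  by move=> /(coset_eqP _ _ sL) /LM /(coset_eqP _ _ sM).
have fL : finite_index M L.
  by apply: (sub_finite_set _ fGL) => S [x /MG Gx <-]; exists x.
exists (sub_index G M), (sub_index M L); split=> //.
by apply: (has_index_uniq GL); apply: has_index_trans sG sL sM LM MG _ _.
Qed.

(** The pair of classes modulo [A] and [B] bounds the index by [a * b]; conversely [a] and [b] both
    divide it, and so does their product by coprimality. *)
Lemma has_indexI_coprime G A B a b : subgroup G -> subgroup A -> subgroup B ->
  A `<=` G -> B `<=` G -> coprime a b ->
  has_index G A a -> has_index G B b -> has_index G (A `&` B) (a * b).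
Proof.
move=> sG sA sB AG BG co HA HB.
have sAB := subgroupI sA sB; have G0 := subgroup0 sG.
have [g gP _] := has_index_classifier sA G0 HA.
have [h hP _] := has_index_classifier sB G0 HB.
have [n Hn] : exists2 n, has_index G (A `&` B) n & (n <= #|{: 'I_a * 'I_b}|)%N.
  apply: (@has_index_le _ _ _ (fun x => (g x, h x))) => // x y Gx Gy [e1 e2].
  by split; [apply/gP | apply/hP].
rewrite card_prod !card_ord => nle.
have n0 := has_index_gt0 G0 Hn.
have [a' [b' [Ha _ na]]] := has_index_factor sG sAB sA (@subIsetl _ _ _) AG Hn.
have [a2 [b2 [Hb _ nb]]] := has_index_factor sG sAB sB (@subIsetr _ _ _) BG Hn.
have ab : (a * b %| n)%N.
  rewrite Gauss_dvd// {1}na nb -(has_index_uniq HA Ha) -(has_index_uniq HB Hb).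
  by rewrite !dvdn_mulr.
by have -> : (a * b)%N = n by apply/eqP; rewrite eqn_leq nle dvdn_leq.
Qed.

Lemma has_index_inj (W : zmodType) (f : {additive V -> W}) G L n : injective f ->
  subgroup L -> has_index G L n -> has_index (f @` G) (f @` L) n.
Proof.
move=> fi sL /has_indexP H; apply/has_indexP; apply: card_eq_trans H.
have sfL : subgroup (f @` L) by exact: subgroup_image.
rewrite card_eq_sym.
suff -> : cosets (f @` G) (f @` L) = (fun x => [set f x + z | z in f @` L]) @` G.
  apply: cosets_card => // x y Gx Gy; rewrite (coset_eqP _ _ sfL) -raddfB.
  by split=> [[z Lz /fi <-]//|]; exists (x - y).
by rewrite /cosets image_comp.
Qed.

(* The cyclic extension [L + Zx]; its index over L is the order of x modulo L. *)
Lemma cyclic_extension G L n x : subgroup G -> subgroup L -> L `<=` G ->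
  has_index G L n -> G x ->
  exists (K : set V) (o : nat), [/\ subgroup K, L `<=` K /\ K `<=` G, K x,
    has_index K L o & forall i, L (x *+ i) <-> (o %| i)%N].
Proof.
move=> sG sL LG H Gx.
have [g gP _] := has_index_classifier sL (subgroup0 sG) H.
have GM i : G (x *+ i) by exact: subgroupMn.
have LB i j : (i <= j)%N -> L (x *+ j - x *+ i) -> L (x *+ (j - i)).
  by move=> ij; rewrite mulrnBr.
(* Pigeonhole: among [n.+1] multiples of [x] two are congruent modulo [L], so [x] has a finite order
   modulo [L]; the least one is [o]. *)
have ex : exists i, (0 < i)%N && `[<L (x *+ i)>].
  have /injectivePn[i [j ij e]] : ~~ injectiveb (fun i : 'I_n.+1 => g (x *+ i)).
    apply/injectiveP => /leq_card; by rewrite !card_ord ltnn.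
  wlog lt : i j ij e / (i < j)%N => [hw|].
    have [lt|lt|/val_inj e'] := ltngtP i j; [exact: (hw i j)| |].
      by apply: (hw j i) => //; rewrite eq_sym.
    by rewrite e' eqxx in ij.
  exists (j - i)%N; rewrite subn_gt0 lt; apply/asboolP/LB; first exact: ltnW.
  by apply/gP.
case: (ex_minnP ex) => o /andP[o0 /asboolP Lo] omin.
have LP i : L (x *+ i) <-> (o %| i)%N.
  split=> [Li|/dvdnP[k ->]]; last by rewrite mulnC mulrnA; apply: subgroupMn.
  have : L (x *+ (i %% o)).
    have -> : (i %% o = i - i %/ o * o)%N by rewrite {2}(divn_eq i o) addKn.
    apply: LB; first exact: leq_trunc_div.
    by apply: subgroupB => //; rewrite mulnC mulrnA; apply: subgroupMn.
  have [/eqP//|nz Lm] := posnP (i %% o)%N.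
  have := omin (i %% o)%N; rewrite nz leqNgt ltn_pmod//=.
  by move/asboolP: Lm => -> /(_ isT).
pose K := [set y | exists i, L (y - x *+ i)].
have sK : subgroup K.
  split; first by exists 0%N; rewrite mulr0n subrr; apply: subgroup0.
  (* Multipliers are natural numbers, so [- j] is replaced by [o.-1 * j], which is congruent to it
     modulo [o]. *)
  move=> y z [i Hy] [j Hz]; exists (i + o.-1 * j)%N.
  have -> : y - z - x *+ (i + o.-1 * j) = (y - x *+ i) - (z - x *+ j) - x *+ (o * j).
    rewrite -{2}(prednK o0) mulSn !mulrnDr !opprD !opprK.
    rewrite -!addrA; congr (_ + _).
    rewrite [RHS]addrCA; congr (_ + _); congr (_ + _).
    by rewrite [in RHS]addrA addrN add0r.
  by apply: subgroupB => //; [apply: subgroupB|rewrite mulrnA; apply: subgroupMn].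
exists K, o; split=> //; first split.
- by move=> y Ly; exists 0%N; rewrite mulr0n subr0.
- by move=> y [i] /LG /(subgroup_subl sG); apply.
- by exists 1%N; rewrite mulr1n subrr; apply: subgroup0.
rewrite -[o]card_ord.
have Ki y : K y -> exists i : 'I_o, L (y - x *+ i).
  case=> i Hi; exists (Ordinal (ltn_pmod i o0)) => /=.
  rewrite {1}(divn_eq i o) mulrnDr opprD addrA addrAC in Hi.
  by apply: (subgroup_subl sL Hi); rewrite mulnC mulrnA; apply: subgroupMn.
pose k y := odflt (Ordinal o0) [pick i : 'I_o | `[<L (y - x *+ i)>]].
have kP y : K y -> L (y - x *+ k y).
  move=> /Ki[i Hi]; rewrite /k; case: pickP => [j /asboolP//|/(_ i)].
  by move/asboolP: Hi => ->.
have ku y (i : 'I_o) : K y -> L (y - x *+ i) -> k y = i.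
  move=> /kP; move: (k y) => j.
  wlog le : i j / (j <= i)%N => [hw Hj Hi|Hj Hi].
    have [le|/ltnW le] := leqP j i; [exact: hw|apply/esym; exact: hw].
  have : L (x *+ (i - j)).
    apply: LB => //; have := subgroupB sL Hj Hi.
    by rewrite opprB addrC addrA addrNK.
  rewrite LP => d; apply: val_inj => /=; apply/eqP.
  rewrite eqn_leq le /= -subn_eq0 eqn0Ngt; apply/negP => lt.
  have := dvdn_leq lt d; rewrite leqNgt => /negP; apply.
  exact: leq_ltn_trans (leq_subr _ _) (ltn_ord i).
apply: (@has_index_of_fun _ _ _ k) => //.
  move=> y z Ky Kz; split=> [e|Lyz].
    have := subgroupB sL (kP _ Ky) (kP _ Kz); rewrite e.
    by rewrite opprB addrA addrNK.
  apply: ku => //; have := subgroupD sL Lyz (kP _ Kz).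
  by rewrite addrA addrNK.
move=> i; have Kx : K (x *+ i) by exists i; rewrite subrr; apply: subgroup0.
by exists (x *+ i) => //; apply: ku => //; rewrite subrr; apply: subgroup0.
Qed.

(** Lagrange: the order of [x] modulo [L] is the index of [L] in [L + Zx], hence divides [n]. *)
Lemma has_index_mulrn G L n x : subgroup G -> subgroup L -> L `<=` G ->
  has_index G L n -> G x -> L (x *+ n).
Proof.
move=> sG sL LG H Gx.
have [K [o [sK [LK KG] _ HK /(_ n) P]]] := cyclic_extension sG sL LG H Gx.
have [a [b [_ Hb nab]]] := has_index_factor sG sL sK LK KG H.
by apply/P; rewrite nab (has_index_uniq HK Hb) dvdn_mull.
Qed.

Lemma has_index1 G L : subgroup G -> subgroup L -> L `<=` G ->
  has_index G L 1 -> L = G.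
Proof.
move=> sG sL LG H; apply/seteqP; split=> // x Gx.
by rewrite -[x]mulr1n; apply: has_index_mulrn H Gx.
Qed.

(** A form of Cauchy's theorem, by induction on the index. For [x] outside [L], the index of [L] in
    [K = L + Zx] is the order of [x] modulo [L] and divides [m]. If [p] does not divide it, [p]
    divides the smaller index of [K] in [G]. *)
Lemma prime_dvd_has_index G L n m p : subgroup G -> subgroup L -> L `<=` G ->
  has_index G L n -> (forall x, G x -> L (x *+ m)) ->
  prime p -> (p %| n)%N -> (p %| m)%N.
Proof.
move=> sG + + + + pp; elim/ltn_ind: n L => n IH L sL LG H ann pn.
have [GL|/existsNP[x /not_implyP[Gx nLx]]] := pselect (G `<=` L).
  have e : L = G by apply/seteqP.
  rewrite e in H; move: pn; rewrite (has_index_uniq H (has_index_self sG)).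
  by rewrite Euclid_dvd1.
have [K [o [sK [LK KG] Kx HK P]]] := cyclic_extension sG sL LG H Gx.
have [a [b [Ha Hb nab]]] := has_index_factor sG sL sK LK KG H.
have ob := has_index_uniq HK Hb; subst o.
have bm : (b %| m)%N by apply/P/ann.
have n0 := has_index_gt0 (subgroup0 sG) H.
have b1 : (1 < b)%N.
  rewrite ltn_neqAle (has_index_gt0 (subgroup0 sK) HK) andbT.
  by apply/negP => /eqP e; apply: nLx; rewrite -[x]mulr1n; apply/P; rewrite -e.
move: pn; rewrite nab Euclid_dvdM// => /orP[pa|pb]; last exact: dvdn_trans bm.
apply: (IH a _ K) => //; last by move=> y /ann /LK.
rewrite nab -[ltnLHS]muln1 ltn_pmul2l//.
by move: n0; rewrite nab muln_gt0 => /andP[].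
Qed.

End Index.

(** * Primary parts *)

Section PrimaryParts.
Context {V : zmodType}.
Implicit Types (G L M : set V) (x y : V).

(** The multiplier [n] is the factor to be removed: if [L] has index [m * n] with [m], [n] coprime,
    then [part n G L] has index [m]. *)
Definition part (n : nat) G L : set V := [set x | G x /\ L (x *+ n)].

(** The quotient [G / primary p G L] is the [p]-component of [G / L] when the latter is finite. *)
Definition primary (p : nat) G L : set V :=
  [set x | G x /\ exists2 n, ~~ (p %| n)%N & L (x *+ n)].

Lemma part_subset n G L : part n G L `<=` G.
Proof. by move=> x []. Qed.

Lemma subset_part n G L : subgroup L -> L `<=` G -> L `<=` part n G L.
Proof. by move=> sL LG x Lx; split; [exact: LG | exact: subgroupMn]. Qed.

Lemma subgroup_part n G L : subgroup G -> subgroup L -> subgroup (part n G L).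
Proof.
move=> sG sL; split; first by split; rewrite ?mul0rn; apply: subgroup0.
move=> x y [Gx Lx] [Gy Ly]; split; first exact: subgroupB.
by rewrite mulrnBl; apply: subgroupB.
Qed.

Lemma primary_subset p G L : primary p G L `<=` G.
Proof. by move=> x []. Qed.

Lemma part_setI G L m n : subgroup G -> subgroup L -> L `<=` G -> coprime m n ->
  part n G L `&` part m G L = L.
Proof.
move=> sG sL LG co; apply/seteqP; split=> [x [[_ Ln] [_ Lm]]|x Lx].
  exact: subgroup_coprime co Lm Ln.
by split; apply: subset_part.
Qed.

(** [L] has index [n] in [M], so [n] maps [M] into [L]. Conversely, if [x *+ n] lies in [L], then
    [M] contains both [x *+ n] and [x *+ m], hence [x]. Thus [M] is recovered from [L] and the two
    indices. *)
Lemma eq_part G L M m n : subgroup G -> subgroup L -> subgroup M ->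
  L `<=` M -> M `<=` G -> coprime m n ->
  has_index G L (m * n) -> has_index G M m -> M = part n G L.
Proof.
move=> sG sL sM LM MG co HL HM.
have [a [b [Ha Hb e]]] := has_index_factor sG sL sM LM MG HL.
have m0 := has_index_gt0 (subgroup0 sG) HM.
have {e}bn : b = n.
  by apply/eqP; rewrite -(eqn_pmul2l m0) e (has_index_uniq HM Ha).
subst b; apply/seteqP; split=> [x Mx|x [Gx Lx]].
  by split; [exact: MG | exact: (has_index_mulrn sM sL LM Hb)].
apply: (subgroup_coprime sM co) (LM _ Lx).
exact: (has_index_mulrn sG sM MG HM).
Qed.

(** Let [a], [b] be the indices of [part n G L] and [part m G L]. Then [a] divides [m] and [b]
    divides [n], while [a * b = m * n] because the two parts meet in [L]; so [a = m]. *)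
Lemma has_index_part G L m n : subgroup G -> subgroup L -> L `<=` G ->
  coprime m n -> has_index G L (m * n) -> has_index G (part n G L) m.
Proof.
move=> sG sL LG co H.
have mn0 := has_index_gt0 (subgroup0 sG) H.
have [m0 n0] : (0 < m /\ 0 < n)%N by apply/andP; rewrite -muln_gt0.
have sP k := subgroup_part k sG sL.
have fin k : exists2 a, has_index G (part k G L) a & (a %| m * n)%N.
  have [a [b [Ha _ ->]]] := has_index_factor sG sL (sP k)
    (@subset_part k G L sL LG) (@part_subset k G L) H.
  by exists a; rewrite ?dvdn_mulr.
(* Multiplication by [k] sends [G] into [part l G L], so every prime factor of [a] divides [k].
   Hence [a] is prime to [l], and [a] divides [k * l]. *)
have cop k l a : (k * l = m * n)%N -> (0 < k)%N -> coprime k l ->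
    has_index G (part l G L) a -> (a %| m * n)%N -> (a %| k)%N.
  move=> kl k0 ckl Ha amn.
  have : coprime a l.
    have a0 := has_index_gt0 (subgroup0 sG) Ha.
    rewrite coprime_has_primes//; last first.
      by move: mn0; rewrite -kl muln_gt0 => /andP[].
    apply/hasPn => q; rewrite !mem_primes => /and3P[pq l0 ql].
    apply/negP => /and3P[_ _ qa].
    have qk : (q %| k)%N.
      apply: (prime_dvd_has_index sG (sP l) (@part_subset l G L) Ha _ pq qa).
      move=> x Gx; split; first exact: subgroupMn.
      by rewrite -mulrnA kl; apply: has_index_mulrn H Gx.
    have := dvdn_gcd q k l; rewrite qk ql (eqP ckl) dvdn1 => /eqP q1.
    by rewrite q1 in pq.
  by move=> cal; rewrite -(Gauss_dvdl _ cal) kl.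
have [a Ha amn] := fin n; have [b Hb bmn] := fin m.
have am := cop _ _ _ erefl m0 co Ha amn.
have bn : (b %| n)%N.
  by apply: (cop n m b) => //; rewrite ?[(n * m)%N]mulnC// coprime_sym.
have cab : coprime a b by apply: coprime_dvdl am _; apply: coprime_dvdr bn _.
have HI := has_indexI_coprime sG (sP n) (sP m)
  (@part_subset n G L) (@part_subset m G L) cab Ha Hb.
rewrite (part_setI sG sL LG co) in HI.
have e := has_index_uniq HI H.
suff <- : a = m by [].
apply/eqP; rewrite eqn_leq dvdn_leq//= leqNgt; apply/negP => lt.
have : (a * b < m * n)%N.
  apply: (@leq_ltn_trans (a * n)); first by rewrite leq_mul2l dvdn_leq ?orbT.
  by rewrite ltn_pmul2r.
by rewrite e ltnn.
Qed.

(** A single multiplier [n] suffices: if [x *+ k] is in [L] with [k] prime to [p], then both [k] and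
    the [p]-power [m] send [x *+ n] into [L]. *)
Lemma primaryE p G L m n : subgroup G -> subgroup L -> L `<=` G ->
  prime p -> p.-nat m -> ~~ (p %| n)%N -> has_index G L (m * n) ->
  primary p G L = part n G L.
Proof.
move=> sG sL LG pp pm pn H; apply/seteqP; split=> x [Gx].
  case=> k pk Lk; split=> //; apply: (subgroup_coprime sL (m := k) (n := m)).
  - by rewrite coprime_sym; apply: pnat_coprime pm _; rewrite p'natE.
  - by rewrite -mulrnA mulnC mulrnA; apply: subgroupMn.
  - by rewrite -mulrnA mulnC; apply: has_index_mulrn H Gx.
by move=> Ln; split=> //; exists n.
Qed.

Lemma has_index_primary p G L N : subgroup G -> subgroup L -> L `<=` G ->
  prime p -> has_index G L N ->
  has_index G (primary p G L) (p ^ logn p N).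
Proof.
move=> sG sL LG pp; have [->|N0] := posnP N.
  by move=> /(has_index_gt0 (subgroup0 sG)).
rewrite -p_part -{1}(partnC p N0) => H.
rewrite (primaryE sG sL LG pp (part_pnat _ _) _ H) -?p'natE ?part_pnat//.
by apply: has_index_part H => //; rewrite coprime_partC.
Qed.

Lemma primary_part p G L n : subgroup L -> L `<=` G -> prime p -> ~~ (p %| n)%N ->
  primary p G (part n G L) = primary p G L.
Proof.
move=> sL LG pp pn; apply/seteqP; split=> x [Gx [k pk]].
  move=> [Gk Lk]; split=> //; exists (k * n)%N; last by rewrite mulrnA.
  by rewrite Euclid_dvdM// negb_or pk.
by move=> Lk; split=> //; exists k => //; apply: subset_part.
Qed.

Lemma primary_coprime p G L N : subgroup G -> subgroup L -> L `<=` G ->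
  has_index G L N -> ~~ (p %| N)%N -> primary p G L = G.
Proof.
move=> sG sL LG H pN; apply/seteqP; split; first exact: primary_subset.
by move=> x Gx; split=> //; exists N => //; apply: has_index_mulrn H Gx.
Qed.

(** Suppose the order [o] of [x] modulo [L] is not 1 and let [p] be its least prime factor.
    Membership in the [p]-primary part makes [o] divide some [k] prime to [p], a contradiction. *)
Lemma mem_primary_all G L N x : subgroup G -> subgroup L -> L `<=` G ->
  has_index G L N -> G x ->
  (forall p, prime p -> (p %| N)%N -> primary p G L x) -> L x.
Proof.
move=> sG sL LG H Gx Px.
have [K [o [_ _ _ _ P]]] := cyclic_extension sG sL LG H Gx.
have oN : (o %| N)%N by apply/P; apply: has_index_mulrn H Gx.
suff o1 : o = 1%N by rewrite -[x]mulr1n; apply/P; rewrite o1.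
apply/eqP/negPn/negP => o1.
have o0 : (0 < o)%N by apply: dvdn_gt0 oN; apply: has_index_gt0 H; apply: subgroup0.
have pp : prime (pdiv o) by apply: pdiv_prime; rewrite ltn_neqAle eq_sym o1.
have [_ [k /negP pk /P ok]] := Px _ pp (dvdn_trans (pdiv_dvd o) oN).
exact/pk/(dvdn_trans (pdiv_dvd o)).
Qed.

(** The product of multipliers for the single [L i] works for all of them and stays prime to [p].
    For [n = 0] the left side would be [G] and the right side everything. *)
Lemma primary_bigcap p G n (L : 'I_n -> set V) : prime p -> (0 < n)%N ->
  (forall i, subgroup (L i)) ->
  primary p G (\bigcap_i L i) = \bigcap_i primary p G (L i).
Proof.
move=> pp n0 sL; apply/seteqP; split=> [x [Gx [k pk Lk]] i _|x H].
  by split=> //; exists k => //; apply: Lk.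
split; first by have [] := H (Ordinal n0) Logic.I.
have /choice[k kP] : forall i, exists k, ~~ (p %| k)%N /\ L i (x *+ k).
  by move=> i; have [_ [k pk Lk]] := H i Logic.I; exists k.
exists (\prod_i k i)%N.
  apply/negP; rewrite Euclid_dvd_prod// big_orE => /existsP[i pi].
  by have [/negP] := kP i.
move=> i _; rewrite (bigD1 i)//= mulrnA; apply: subgroupMn => //.
by have [] := kP i.
Qed.

Lemma bigcap_mulrn_prod G n (M : 'I_n -> set V) (q : 'I_n -> nat) (P : pred 'I_n) x :
  subgroup G -> (forall i, subgroup (M i)) -> (forall i, M i `<=` G) ->
  (forall i, has_index G (M i) (q i)) -> G x -> (forall i, ~~ P i -> M i x) ->
  (\bigcap_i M i) (x *+ (\prod_(i | P i) q i)%N).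
Proof.
move=> sG sM MG H Gx Px i _; have [Pi|/Px Mx] := boolP (P i); last exact: subgroupMn.
rewrite (bigD1 i)//= mulrnA; apply: subgroupMn => //.
exact: has_index_mulrn (H i) Gx.
Qed.

Lemma prime_Ndvd_prod n (p a : 'I_n -> nat) (P : pred 'I_n) q : prime q ->
  (forall i, prime (p i)) -> (forall i, P i -> p i != q) ->
  ~~ (q %| \prod_(i | P i) p i ^ a i)%N.
Proof.
move=> pq pp H; rewrite Euclid_dvd_prod// big_orE; apply/existsP => -[i].
rewrite Euclid_dvdX// dvdn_prime2// => /andP[Pi /andP[/eqP e _]].
by have := H i Pi; rewrite e eqxx.
Qed.

Section Decomposition.
Variables (G : set V) (k : nat) (M : 'I_k -> set V) (p a : 'I_k -> nat).
Hypotheses (sG : subgroup G) (sM : forall i, subgroup (M i))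
  (MG : forall i, M i `<=` G) (pp : forall i, prime (p i)) (p_inj : injective p)
  (H : forall i, has_index G (M i) (p i ^ a i)).

(** An element of the primary part is sent into [M i] by a number prime to [p i] and by [p i ^ a i].
    Conversely, the product of the other indices sends [M i] into the intersection and is prime to
    [p i]. *)
Lemma primary_bigcap_constituent i : primary (p i) G (\bigcap_j M j) = M i.
Proof.
apply/seteqP; split=> [x [Gx [n pn Ln]]|x Mx].
  apply: (subgroup_coprime (sM i) (m := p i ^ a i) (n := n)).
  - by rewrite coprimeXl// prime_coprime.
  - exact: has_index_mulrn (H i) Gx.
  - exact: Ln.
split; first exact: (@MG i).
exists (\prod_(j | j != i) p j ^ a j)%N.
  by apply: prime_Ndvd_prod => // j; apply: contra_neq => /p_inj.
apply: (bigcap_mulrn_prod sG) => //; first exact: (@MG i).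
by move=> j; rewrite negbK => /eqP ->.
Qed.

Lemma primary_bigcap_trivial q : prime q -> (forall i, p i != q) ->
  primary q G (\bigcap_j M j) = G.
Proof.
move=> pq npq; apply/seteqP; split; first exact: primary_subset.
move=> x Gx; split=> //; exists (\prod_(j | true) p j ^ a j)%N.
  exact: prime_Ndvd_prod.
exact: (bigcap_mulrn_prod sG).
Qed.

End Decomposition.

Lemma primary_decomposition_exists G L N : subgroup G -> subgroup L ->
  L `<=` G -> has_index G L N ->
  exists k (p : 'I_k -> nat), [/\ (0 < k)%N, injective p,
    forall i, prime (p i) & L = \bigcap_i primary (p i) G L].
Proof.
(* The prime 2 is added to keep the family nonempty when [N = 1]; if 2 does not divide [N], its
   constituent is [G]. *)
move=> sG sL LG H; pose s := undup (2 :: primes N).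
have s2 : 2 \in s by rewrite mem_undup mem_head.
have sp q : q \in s -> prime q.
  by rewrite mem_undup inE mem_primes => /orP[/eqP -> //|/andP[]].
have memp (i : 'I_(size s)) : nth 0%N s i \in s by exact: mem_nth.
exists (size s), (fun i => nth 0%N s i); split.
- by rewrite lt0n size_eq0; apply/eqP => e; rewrite e in s2.
- move=> i j /eqP; rewrite nth_uniq ?undup_uniq// => /eqP; exact: val_inj.
- by move=> i; apply: sp.
apply/seteqP; split=> [x Lx i _|x Hx].
  split; first exact: LG.
  exists 1%N; rewrite ?mulr1n// dvdn1.
  by apply/eqP => e; have := sp _ (memp i); rewrite e.
have pN q : prime q -> (q %| N)%N -> primary q G L x.
  move=> pq qN; have qs : q \in s.
    rewrite mem_undup inE mem_primes pq qN (has_index_gt0 (subgroup0 sG) H).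
    by rewrite orbT.
  have qs' : (index q s < size s)%N by rewrite index_mem.
  by have := Hx (Ordinal qs') Logic.I; rewrite /= nth_index.
apply: mem_primary_all H _ pN => //.
have s0 : (0 < size s)%N by rewrite lt0n size_eq0; apply/eqP => e; rewrite e in s2.
by have [] := Hx (Ordinal s0) Logic.I.
Qed.

End PrimaryParts.

(** * Index and determinant *)

(** Cosets are classified by the vector of remainders modulo the diagonal entries. *)
Lemma has_index_diag d (s : 'rV[int]_d) : (forall i, s ord0 i != 0) ->
  has_index [set: 'cV[int]_d] (range (mulmx (diag_mx s))) (\prod_i `|s ord0 i|)%N.
Proof.
move=> s0.
have s_gt0 i : (0 < `|s ord0 i|)%N by rewrite absz_gt0.
have lt (z : 'cV[int]_d) i : (`|(z i ord0 %% s ord0 i)%Z| < `|s ord0 i|)%N.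
  rewrite -ltz_nat gez0_abs ?modz_ge0// -modz_abs; apply: ltz_pmod; rewrite ltz_nat.
  exact: s_gt0.
have -> : (\prod_i `|s ord0 i|)%N = #|{dffun forall i : 'I_d, 'I_(`|s ord0 i|)}|.
  rewrite card_dep_ffun foldrE big_map enumT.
  by apply: eq_bigr => i _; rewrite card_ord.
pose g z : {dffun forall i : 'I_d, 'I_(`|s ord0 i|)} :=
  [ffun i => Ordinal (lt z i)].
apply: (has_index_of_fun (g := g)); rewrite /g.
- split; first by exists 0 => //; rewrite mulmx0.
  by move=> _ _ [x _ <-] [y _ <-]; exists (x - y); rewrite ?mulmxBr.
- move=> x y _ _; split=> [e|[z _ e]].
    have e' i : (x i ord0 = y i ord0 %[mod s ord0 i])%Z.
      move/ffunP/(_ i): e; rewrite !ffunE => /(congr1 val) /=.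
      by move=> /(congr1 Posz); rewrite !gez0_abs ?modz_ge0.
    exists (\col_i ((x - y)%R i ord0 %/ s ord0 i)%Z) => //.
    apply/matrixP => i j; rewrite mul_diag_mx !mxE (ord1 j) mulrC divzK//.
    by rewrite -eqz_mod_dvd; apply/eqP; apply: e'.
  apply/ffunP => i; rewrite !ffunE; apply: val_inj => /=; congr absz.
  apply/eqP; rewrite eqz_mod_dvd; apply/dvdzP; exists (z i 0).
  by have := congr1 (fun w : 'cV_d => w i 0) e; rewrite mul_diag_mx !mxE mulrC.
- move=> t; exists (\col_i (val (t i) : int)) => //.
  apply/ffunP => i; rewrite ffunE; apply: val_inj => /=.
  by rewrite mxE -modz_abs modz_small// ltz_nat ltn_ord.
Qed.

Lemma subgroup_range_mulmx (R : pzRingType) d (T : 'M[R]_d) :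
  subgroup (range (fun z : 'cV[R]_d => T *m z)).
Proof.
split; first by exists 0 => //; rewrite mulmx0.
by move=> _ _ [x _ <-] [y _ <-]; exists (x - y); rewrite ?mulmxBr.
Qed.

(** Smith normal form reduces to the diagonal case: the right unimodular factor preserves the
    integer lattice, and the left one transports indices. *)
Lemma has_index_det d (T : 'M[int]_d) : \det T != 0 ->
  has_index [set: 'cV[int]_d] (range (mulmx T)) `|\det T|%N.
Proof.
have [L uL [S uS [s _ ->]]] := int_Smith_normal_form T.
set D := \matrix_(_, _) _.
have -> : D = diag_mx (\row_i s`_i).
  by apply/matrixP => i j; rewrite !mxE.
set w := \row__ _.
have unit1 (M : 'M[int]_d) : M \in unitmx -> `|\det M|%N = 1%N.
  by rewrite unitmxE => /orP[] /eqP ->.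
rewrite !det_mulmx !abszM (unit1 L)// (unit1 S)// mul1n muln1 det_diag => nz.
have -> : absz (\prod_i w ord0 i) = (\prod_i `|w ord0 i|)%N.
  by apply: (big_morph absz) => // x y; rewrite abszM.
have w0 i : w ord0 i != 0.
  apply: contraNneq nz => e; rewrite (bigD1 i)//= e mul0r mulr0 ?mul0r//.
have Linj : injective (mulmx L : 'cV_d -> 'cV_d).
  by apply: can_inj (mulmx (invmx L)) _ => z; rewrite mulKmx.
have := has_index_inj Linj (subgroup_range_mulmx _) (has_index_diag w0).
have -> : mulmx L @` [set: 'cV_d] = [set: 'cV_d].
  by apply/seteqP; split=> // z _; exists (invmx L *m z); rewrite ?mulKVmx.
suff -> : range (mulmx (L *m diag_mx w *m S)) =
    mulmx L @` range (mulmx (diag_mx w)) :> set 'cV_d by [].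
apply/seteqP; split=> [_ [z _ <-]|_ [_ [z _ <-] <-]].
  by exists (diag_mx w *m (S *m z)); [exists (S *m z)|rewrite !mulmxA].
by exists (invmx S *m z) => //; rewrite -!mulmxA mulKVmx.
Qed.

(** * Lattices in real space and their images under isometries *)

Section Lattice.
Variables (R : realType) (d : nat).
Implicit Types (G : set 'cV[R]_d) (A B : 'M[R]_d).

Definition lattice_map B : 'cV[int]_d -> 'cV[R]_d :=
  mulmx B \o map_mx intr.

HB.instance Definition _ B := GRing.Additive.copy (lattice_map B)
  (mulmx B \o map_mx intr).

Lemma lattice_map_inj B : B \in unitmx -> injective (lattice_map B).
Proof.
move=> uB x y /(congr1 (mulmx (invmx B))); rewrite /lattice_map/= !mulKmx//.
by move=> /matrixP e; apply/matrixP => i j; have := e i j; rewrite !mxE => /intr_inj.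
Qed.

Lemma has_index_lattice_map B (T : 'M[int]_d) : B \in unitmx -> \det T != 0 ->
  has_index (range (lattice_map B)) (range (lattice_map (B *m map_mx intr T)))
    `|\det T|%N.
Proof.
move=> uB T0.
have := has_index_inj (lattice_map_inj uB) (subgroup_range_mulmx _)
  (has_index_det T0).
suff -> : range (lattice_map (B *m map_mx intr T)) =
    lattice_map B @` range (mulmx T) by [].
rewrite image_comp; apply: eq_imagel => z _ /=.
by rewrite /lattice_map/= map_mxM mulmxA.
Qed.

Lemma is_lattice_subgroup G : is_lattice G -> subgroup G.
Proof.
move=> [B _ ->]; split; first by exists 0 => //; rewrite map_mx0 mulmx0.
move=> _ _ [x _ <-] [y _ <-]; exists (x - y) => //.
by rewrite map_mxB mulmxBr.
Qed.

Lemma orthogonal_mxP A : orthogonal_mx A -> A \in unitmx /\ `|\det A| = 1.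
Proof.
move=> oA; have /eqP : \det A * \det A = 1.
  by rewrite -{1}det_tr -det_mulmx oA det1.
rewrite -expr2 sqrf_eq1 unitmxE => /orP[] /eqP ->.
  by rewrite unitr1 normr1.
by rewrite unitrN1 normrN1.
Qed.

Lemma has_index_muln G N : is_lattice G -> (0 < N)%N ->
  has_index G [set x *+ N | x in G] (N ^ d).
Proof.
move=> [B uB ->] N0.
have nz : \det (N%:R%:M : 'M[int]_d) != 0.
  by rewrite det_scalar expf_neq0// pnatr_eq0 -lt0n.
have := has_index_lattice_map uB nz.
rewrite det_scalar abszX -[absz _]/(absz (N%:R : int)) [absz _](_ : _ = N).
  2: by rewrite natz.
suff -> : [set x *+ N | x in range (fun z : 'cV[int]_d => B *m map_mx intr z)] =
  range (lattice_map (B *m map_mx intr N%:R%:M)) by [].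
rewrite image_comp; apply: eq_imagel => z _ /=.
rewrite /lattice_map/= map_scalar_mx mul_mx_scalar -scalemxAl rmorph_nat.
by rewrite scaler_nat.
Qed.

Lemma subgroup_csl G A : subgroup G -> subgroup (csl G A).
Proof. by move=> sG; apply: subgroupI => //; apply: subgroup_image. Qed.

(* [N G = A B T Z^d] for an integer matrix [T], and [|det T| = N^d] as [|det A| = 1]. *)
Lemma has_index_orthogonal_muln G A N : is_lattice G -> orthogonal_mx A ->
  (0 < N)%N -> [set x *+ N | x in G] `<=` mulmx A @` G ->
  has_index (mulmx A @` G) [set x *+ N | x in G] (N ^ d).
Proof.
move=> [B uB eG] oA N0 sub; have [uA dA] := orthogonal_mxP oA.
(* [t j] is the integer coordinate vector of [N] times the [j]-th column of [B] in the basis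
   [A *m B] of the image of [G]. *)
have /choice[t tP] : forall j, exists z : 'cV[int]_d,
    A *m (B *m map_mx intr z) = col j B *+ N.
  move=> j; have : (mulmx A @` G) (col j B *+ N).
    apply: sub; exists (col j B) => //; rewrite eG; exists (delta_mx j 0) => //.
    by rewrite map_delta_mx colE.
  by rewrite eG => -[_ [z _ <-] e]; exists z.
pose T : 'M[int]_d := \matrix_(i, j) t j i 0.
have eT : A *m B *m map_mx intr T = B *+ N.
  have colT j : map_mx intr (t j) = col j (map_mx intr T) :> 'cV[R]_d.
    by apply/matrixP => i k; rewrite !mxE (ord1 k).
  apply/matrixP => i j; have := congr1 (fun w : 'cV_d => w i 0) (tP j).
  by rewrite colT !colE !mulmxA -!colE !mulmxnE ![col _ _ _ _]mxE.
have : `|\det (map_mx intr T : 'M[R]_d)| = (N ^ d)%:R.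
  have := congr1 (fun M => `|\det M|) eT.
  rewrite -scaler_nat detZ !det_mulmx !normrM dA mul1r mulrC.
  rewrite normrX normr_nat natrX => /mulIf; apply.
  by rewrite normr_eq0 -unitfE -unitmxE.
rewrite det_map_mx -intr_norm [RHS]pmulrn => /intr_inj e.
have aT : `|\det T|%N = (N ^ d)%N by apply/eqP; rewrite -eqz_nat abszE e.
have nz : \det T != 0 by rewrite -absz_gt0 aT expn_gt0 N0.
have uAB : A *m B \in unitmx by rewrite unitmx_mul uA.
have := has_index_lattice_map uAB nz; rewrite aT eT.
have -> : range (lattice_map (A *m B)) = mulmx A @` G.
  rewrite eG image_comp; apply: eq_imagel => z _ /=.
  by rewrite /lattice_map/= mulmxA.
suff -> : range (lattice_map (B *+ N)) = [set x *+ N | x in G] by [].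
rewrite eG image_comp; apply: eq_imagel => z _ /=.
by rewrite /lattice_map/= -scaler_nat -scalemxAl scaler_nat.
Qed.

(** With [N] the index of the CSL in [G], the lattice [NG] lies in the CSL and has index [N ^ d]
    both in [G] and in the image of [G]. Cancelling its index in the CSL gives the same value on
    both sides. *)
Lemma has_index_csl_image G A : is_lattice G -> coincidence_isometry G A ->
  has_index (mulmx A @` G) (csl G A) (sub_index G (csl G A)).
Proof.
move=> lG [oA fin]; set N := sub_index _ _.
have sG := is_lattice_subgroup lG.
have sC := subgroup_csl A sG.
have sAG : subgroup (mulmx A @` G) by apply: subgroup_image.
have CG : csl G A `<=` G by apply: subIsetl.
have CAG : csl G A `<=` mulmx A @` G by apply: subIsetr.
have H : has_index G (csl G A) N by [].
have N0 : (0 < N)%N by apply: has_index_gt0 H; apply: subgroup0.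
have sNG : subgroup [set x *+ N | x in G] by exact: subgroup_muln.
have sub : [set x *+ N | x in G] `<=` csl G A.
  by move=> _ [x Gx <-]; apply: has_index_mulrn H Gx.
have H1 := has_index_muln lG N0.
have H2 := has_index_orthogonal_muln lG oA N0 (subset_trans sub CAG).
have [a [b [Ha Hb e1]]] := has_index_factor sG sNG sC sub CG H1.
have [a' [b' [Ha' Hb' e2]]] := has_index_factor sAG sNG sC sub CAG H2.
rewrite (has_index_uniq H Ha); suff -> : a = a' by [].
have b0 := has_index_gt0 (subgroup0 sC) Hb.
by apply/eqP; rewrite -(eqn_pmul2r b0) -e1 e2 (has_index_uniq Hb Hb').
Qed.

End Lattice.

(** * Coincidence site lattices *)

Section FsetCard.
Context {T U : choiceType}.

Lemma cardfs_image_inj (A : set T) (f : T -> U) : finite_set A ->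
  {in A &, injective f} ->
  #|` fset_set (f @` A)|%fset = #|` fset_set A|%fset.
Proof.
move=> fA fi; have ffA : finite_set (f @` A) by exact: finite_image.
by apply/(fcard_eq ffA fA); apply: inj_card_eq.
Qed.

Lemma leq_cardfs_subset (A B : set T) : finite_set B -> A `<=` B ->
  (#|` fset_set A| <= #|` fset_set B|)%N.
Proof.
move=> fB AB; apply: fsubset_leq_card.
by rewrite -fset_set_sub//; apply: sub_finite_set fB.
Qed.

Lemma subset_cardfs_eq (A B : set T) : finite_set B -> A `<=` B ->
  (#|` fset_set B| <= #|` fset_set A|)%N -> A = B.
Proof.
move=> fB AB le; have fA := sub_finite_set AB fB.
apply: (fset_set_inj fA fB); apply/eqP.
by rewrite eqEfcard le andbT -fset_set_sub.
Qed.

Lemma cardfsM (A : {fset T}) (B : {fset U}) :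
  #|` (A `*` B)%fset| = (#|` A| * #|` B|)%N.
Proof.
rewrite -(size_allpairs pair); apply/perm_size/uniq_perm.
- exact: fset_uniq.
- by apply: allpairs_uniq; rewrite ?fset_uniq// => -[? ?] [? ?].
move=> [x y]; rewrite in_fsetM; apply/andP/allpairsP => [[Ax By]|].
  by exists (x, y).
by move=> [[x' y'] [Ax By [-> ->]]].
Qed.

End FsetCard.

(** * Products of coincidence isometries and the count of CSLs *)

Section CoincidenceLattices.
Variables (R : realType) (d : nat) (G : set 'cV[R]_d).
Hypothesis lG : is_lattice G.
Implicit Types (L C D : set 'cV[R]_d) (A B : 'M[R]_d).

Let sG : subgroup G := is_lattice_subgroup lG.

Definition is_csl L : Prop := exists2 A, coincidence_isometry G A & L = csl G A.

Lemma csls_of_indexP m L :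
  csls_of_index G m L <-> is_csl L /\ has_index G L m.
Proof.
split=> [[A [cA -> e]]|[[A cA ->] [_ e]]]; last by exists A.
by split; [exists A|split=> //; case: cA].
Qed.

Lemma is_csl_subgroup L : is_csl L -> subgroup L /\ L `<=` G.
Proof. by case=> A _ ->; split; [exact: subgroup_csl|exact: subIsetl]. Qed.

Lemma is_csl_has_index L : is_csl L -> exists m, has_index G L m.
Proof. by case=> A [_ fA] ->; exists (sub_index G (csl G A)). Qed.

Lemma csl1 : csl G 1%:M = G.
Proof.
rewrite /csl [X in _ `&` X](_ : _ = G) ?setIid//.
by rewrite -[RHS]image_id; apply: eq_imagel => x _; rewrite mul1mx.
Qed.

Lemma is_csl_self : is_csl G.
Proof.
exists 1%:M; last by rewrite csl1.
split; first by rewrite /orthogonal_mx trmx1 mulmx1.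
by rewrite csl1; case: (has_index_self sG).
Qed.

(** A sublattice of index [m] contains [mG], so it is determined by the set of classes modulo [mG]
    that it meets. *)
Lemma finite_csls_of_index m : (0 < m)%N -> finite_set (csls_of_index G m).
Proof.
move=> m0; have sNG : subgroup [set x *+ m | x in G] by exact: subgroup_muln.
have [g gP _] := has_index_classifier sNG (subgroup0 sG) (has_index_muln lG m0).
have sub L L' : csls_of_index G m L -> csls_of_index G m L' ->
    [set i | `[<(g @` L) i>]]%SET = [set i | `[<(g @` L') i>]]%SET -> L `<=` L'.
  move=> /csls_of_indexP[/is_csl_subgroup[sL LG] _].
  move=> /csls_of_indexP[/is_csl_subgroup[sL' LG'] H'] e x Lx.
  have : g x \in [set i | `[<(g @` L) i>]]%SET.
    by rewrite inE; apply/asboolP; exists x.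
  rewrite e inE => /asboolP[y Ly] /esym /gP [||z Gz xy]; [exact: LG|exact: LG'|].
  apply: (subgroup_subl sL' _ Ly); rewrite -xy.
  exact: (has_index_mulrn sG sL' LG' H').
rewrite -[csls_of_index G m]image_id.
apply: (card_le_finite (card_le_image_fiber
  (h := fun L => [set i | `[<(g @` L) i>]]%SET) _)).
  move=> L L' /[!inE] HL HL' e.
  by apply/seteqP; split; apply: sub.
exact: finite_finset.
Qed.

(** An [x] in [G] and in [G2 = ABG] satisfies [x *+ m] and [x *+ n] in [G1 = AG], hence lies in
    [G1]; so the CSL of [A *m B] is [csl G A] met with [D]. The last clause recovers [csl G B] once
    [A] is known. *)
Lemma csl_mul A B m n : coincidence_isometry G A -> coincidence_isometry G B ->
  has_index G (csl G A) m -> has_index G (csl G B) n -> coprime m n ->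
  [/\ coincidence_isometry G (A *m B), csl G (A *m B) `<=` csl G A,
    has_index G (csl G (A *m B)) (m * n) &
    mulmx A @` csl G B = part m (mulmx A @` G) (csl G (A *m B))].
Proof.
move=> cA cB HA HB co; have [oA _] := cA; have [oB _] := cB.
have [uA _] := orthogonal_mxP oA.
have Ainj : injective (mulmx A : 'cV_d -> 'cV_d).
  by apply: can_inj (mulmx (invmx A)) _ => z; rewrite mulKmx.
have HA1 := has_index_csl_image lG cA; have [_ eA] := HA; rewrite eA in HA1.
have HB1 := has_index_csl_image lG cB; have [_ eB] := HB; rewrite eB in HB1.
have sA := subgroup_csl A sG; have sB := subgroup_csl B sG.
pose G1 := mulmx A @` G; pose G2 := mulmx (A *m B) @` G.
pose D := mulmx A @` csl G B.
have eG2 : mulmx A @` (mulmx B @` G) = G2.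
  by rewrite image_comp; apply: eq_imagel => z _ /=; rewrite mulmxA.
have sG1 : subgroup G1 by apply: subgroup_image.
have sG2 : subgroup G2 by apply: subgroup_image.
have sD : subgroup D by apply: subgroup_image.
have eD : D = G1 `&` G2.
  rewrite -eG2; apply/seteqP; split=> [_ [z [Gz Bz] <-]|_ [[z Gz <-] [y By /Ainj e]]].
    by split; exists z.
  by exists z => //; split=> //; rewrite -e.
have HD1 : has_index G1 D n := has_index_inj Ainj sB HB.
have HD2 : has_index G2 D n by rewrite -eG2; apply: has_index_inj Ainj sB HB1.
have DG1 : D `<=` G1 by rewrite eD; apply: subIsetl.
have DG2 : D `<=` G2 by rewrite eD; apply: subIsetr.
have CG : csl G A `<=` G by apply: subIsetl.
have CG1 : csl G A `<=` G1 by apply: subIsetr.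
have eL : csl G (A *m B) = csl G A `&` D.
  apply/seteqP; split=> x; last by rewrite eD => -[[Gx _] [_ G2x]].
  move=> [Gx G2x]; suff G1x : G1 x by rewrite eD.
  apply: (subgroup_coprime sG1 co).
    exact/CG1/(has_index_mulrn sG sA CG HA Gx).
  exact/DG1/(has_index_mulrn sG2 sD DG2 HD2 G2x).
have sL := subgroup_csl (A *m B) sG.
(* [D] need not lie in [G], so the index is first computed in [G1], then transferred to [G] through
   [csl G A], which has index [m] in both. *)
have HL1 : has_index G1 (csl G (A *m B)) (m * n).
  by rewrite eL; apply: has_indexI_coprime.
have LC : csl G (A *m B) `<=` csl G A by rewrite eL; apply: subIsetl.
have [a [b [Ha Hb ab]]] := has_index_factor sG1 sL sA LC CG1 HL1.
have m0 := has_index_gt0 (subgroup0 sG) HA.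
have {ab}bn : b = n.
  by apply/eqP; rewrite -(eqn_pmul2l m0) ab (has_index_uniq HA1 Ha).
subst b.
have HL : has_index G (csl G (A *m B)) (m * n) by apply: has_index_trans HA Hb.
split=> //; first split.
- rewrite /orthogonal_mx trmx_mul mulmxA -(mulmxA B^T) oA mulmx1; exact: oB.
- by case: HL.
- apply: (eq_part sG1 sL sD _ DG1 (m := n)) => //.
  + by rewrite eL; apply: subIsetr.
  + by rewrite coprime_sym.
  + by rewrite mulnC.
Qed.

(** Two injections on pairs of CSLs are compared: [phi] lands in the CSLs of index [m * n] and [psi]
    has image [P]. Thus [P] has [f(m) f(n)] elements, at most [f(m * n)], and both claims follow by
    counting. *)
Lemma csl_count_coprime m n : (0 < m)%N -> (0 < n)%N -> coprime m n ->
  let P := [set C `&` D | C in csls_of_index G m & D in csls_of_index G n] in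
  (csls_of_index G (m * n) `<=` P -> P = csls_of_index G (m * n) /\
    csl_count G (m * n) = (csl_count G m * csl_count G n)%N) /\
  (csl_count G (m * n) = (csl_count G m * csl_count G n)%N ->
    forall L, csls_of_index G (m * n) L -> csls_of_index G m (part n G L)).
Proof.
move=> m0 n0 co P.
pose X := csls_of_index G m; pose Y := csls_of_index G n.
pose Z := csls_of_index G (m * n).
have fX : finite_set X by exact: finite_csls_of_index.
have fY : finite_set Y by exact: finite_csls_of_index.
have fZ : finite_set Z by apply: finite_csls_of_index; rewrite muln_gt0 m0.
have fXY : finite_set (X `*` Y) by exact: finite_setX.
have cXY : #|` fset_set (X `*` Y)|%fset = (csl_count G m * csl_count G n)%N.
  by rewrite fset_setX// cardfsM.
(* One isometry is fixed per CSL, with 0 as a dummy value elsewhere; injectivity of [phi] needs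
   [s C] to depend on [C] alone. *)
have /choice[s sP] : forall L, exists A, is_csl L ->
    coincidence_isometry G A /\ L = csl G A.
  move=> L; have [[A cA eL]|nL] := pselect (is_csl L); first by exists A.
  by exists 0.
pose phi CD := csl G (s CD.1 *m s CD.2).
have phiP C D : X C -> Y D -> [/\ Z (phi (C, D)), C = part n G (phi (C, D)) &
    mulmx (s C) @` D = part m (mulmx (s C) @` G) (phi (C, D))].
  move=> /csls_of_indexP[kC HC] /csls_of_indexP[kD HD].
  have [cC eC] := sP C kC; have [cD eD] := sP D kD.
  have HC' := HC; rewrite {1}eC in HC'; rewrite {1}eD in HD.
  have [c1 c2 c3 c4] := csl_mul cC cD HC' HD co.
  rewrite -eC in c2; rewrite -eD in c4.
  split; first by apply/csls_of_indexP; split=> //; exists (s C *m s D).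
    have [sC CG] := is_csl_subgroup kC.
    have sL := subgroup_csl (s C *m s D) sG.
    exact: (eq_part sG sL sC c2 CG co c3).
  exact: c4.
have phi_inj : {in X `*` Y &, injective phi}.
  move=> [C D] [C' D'] /[!inE] -[/= XC YD] [/= XC' YD'] e.
  have [_ e1 e2] := phiP _ _ XC YD; have [_ e1' e2'] := phiP _ _ XC' YD'.
  have CC' : C = C' by rewrite e1 e -e1'.
  subst C'; congr (_, _).
  have DD' : mulmx (s C) @` D = mulmx (s C) @` D' by rewrite e2 e -e2'.
  have /csls_of_indexP[/sP[[oC _] _] _] := XC.
  have [uA _] := orthogonal_mxP oC.
  apply/seteqP; split=> x Dx.
    have : (mulmx (s C) @` D') (s C *m x) by rewrite -DD'; exists x.
    by move=> [y Dy /(can_inj (mulKmx uA)) <-].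
  have : (mulmx (s C) @` D) (s C *m x) by rewrite DD'; exists x.
  by move=> [y Dy /(can_inj (mulKmx uA)) <-].
have phiZ : phi @` (X `*` Y) `<=` Z.
  by move=> _ [[C D] [/= XC YD] <-]; have [] := phiP _ _ XC YD.
have cphi := cardfs_image_inj fXY phi_inj; rewrite cXY in cphi.
pose psi (CD : set 'cV[R]_d * set 'cV[R]_d) := CD.1 `&` CD.2.
have psiE : psi @` (X `*` Y) = P.
  apply/seteqP; split=> [_ [[C D] [/= XC YD] <-]|_ [C XC [D YD <-]]].
    by exists C => //; exists D.
  by exists (C, D).
have psi_part C D : X C -> Y D -> C = part n G (C `&` D) /\ D = part m G (C `&` D).
  move=> /csls_of_indexP[/is_csl_subgroup[sC CG] HC].
  move=> /csls_of_indexP[/is_csl_subgroup[sD DG] HD].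
  have H := has_indexI_coprime sG sC sD CG DG co HC HD.
  have sI := subgroupI sC sD.
  split; first by apply: (eq_part sG sI sC _ CG co).
  apply: (eq_part sG sI sD _ DG _ _ HD) => //; first by rewrite coprime_sym.
  by rewrite mulnC.
have psi_inj : {in X `*` Y &, injective psi}.
  move=> [C D] [C' D'] /[!inE] -[/= XC YD] [/= XC' YD'] e.
  have [e1 e2] := psi_part _ _ XC YD; have [e1' e2'] := psi_part _ _ XC' YD'.
  have e' : C `&` D = C' `&` D' := e.
  by congr (_, _); [rewrite e1 e' -e1' | rewrite e2 e' -e2'].
have cpsi := cardfs_image_inj fXY psi_inj; rewrite cXY psiE in cpsi.
have le : (csl_count G m * csl_count G n <= csl_count G (m * n))%N.
  by rewrite -cphi; apply: leq_cardfs_subset.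
split=> // [ZP|e L ZL].
  have fP : finite_set P.
    by rewrite -psiE; apply: finite_image.
  have ge := leq_cardfs_subset fP ZP; rewrite cpsi in ge.
  split; last by apply/eqP; rewrite eqn_leq ge le.
  by apply/esym/(subset_cardfs_eq fP ZP); rewrite cpsi.
have eZ : phi @` (X `*` Y) = Z.
  by apply: subset_cardfs_eq => //; rewrite cphi -e.
move: ZL; rewrite -/Z -eZ => -[[C D] [/= XC YD] <-].
by have [_ <-] := phiP _ _ XC YD.
Qed.

End CoincidenceLattices.

(** * Multiplicativity and closure under primary parts *)

Section Multiplicativity.
Variables (R : realType) (d : nat) (G : set 'cV[R]_d).
Hypothesis lG : is_lattice G.
Implicit Types (L C D : set 'cV[R]_d) (A B : 'M[R]_d).

Let sG : subgroup G := is_lattice_subgroup lG.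

(** The pivot of the proof: each of the three statements is shown equivalent to it. *)
Definition primary_closed : Prop :=
  forall L p, is_csl G L -> prime p -> is_csl G (primary p G L).

(** If [p] does not divide [n], passing to [part n G L] keeps the [p]-primary part. Otherwise [p]
    does not divide the index [m] of [part n G L], whose [p]-primary part is then [G]. *)
Lemma primary_part_csl L m n p : subgroup L -> L `<=` G -> coprime m n ->
  has_index G L (m * n) -> (forall q, prime q -> is_csl G (primary q G L)) ->
  prime p -> is_csl G (primary p G (part n G L)).
Proof.
move=> sL LG co H kL pp; have [pn|pn] := boolP (p %| n)%N; last first.
  by rewrite primary_part//; apply: kL.
rewrite (primary_coprime sG _ _ (has_index_part sG sL LG co H)).
- exact: is_csl_self.
- exact: subgroup_part.
- exact: part_subset.
apply/negP => pm; have := dvdn_gcd p m n.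
by rewrite pn pm (eqP co) dvdn1 => /eqP p1; rewrite p1 in pp.
Qed.

(** Write [N = q * Q] with [q] the part of [N] at a prime [p]. Then [L] is the intersection of its
    [p]-primary part and of [part q G L], a CSL by induction since [Q < N]; counting shows that such
    intersections are CSLs. *)
Lemma csl_of_primaries N L : primary_closed -> subgroup L -> L `<=` G ->
  has_index G L N -> (forall p, prime p -> is_csl G (primary p G L)) ->
  is_csl G L.
Proof.
move=> closed; elim/ltn_ind: N L => N IH L sL LG H kL.
have N0 := has_index_gt0 (subgroup0 sG) H.
have [N1|N1] := leqP N 1.
  rewrite (has_index1 sG sL LG); first exact: is_csl_self.
  by have e : N = 1%N by [apply/eqP; rewrite eqn_leq N1]; rewrite e in H.
pose p := pdiv N; have pp : prime p by exact: pdiv_prime.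
pose q := (N`_p)%N; pose Q := (N`_p^')%N.
have qQ : (q * Q)%N = N by exact: partnC.
have co : coprime q Q by exact: coprime_partC.
have q0 : (0 < q)%N by exact: part_gt0.
have Q0 : (0 < Q)%N by exact: part_gt0.
have QN : (Q < N)%N.
  rewrite -qQ -{1}[Q]mul1n ltn_pmul2r// ltnNge; apply/negP => q1.
  have : (p %| q)%N.
    by rewrite /q -{1}(part_pnat_id (pnat_id pp)) partn_dvd// pdiv_dvd.
  by move/(dvdn_leq q0) => /leq_trans/(_ q1); rewrite leqNgt prime_gt1.
(* This is applied twice: to all CSLs of index [q * Q], which yields the inclusion required for
   counting, and then to [L] itself. *)
have split L' : subgroup L' -> L' `<=` G -> has_index G L' (q * Q) ->
    (forall p, prime p -> is_csl G (primary p G L')) ->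
    [set C `&` D | C in csls_of_index G q & D in csls_of_index G Q] L'.
  move=> sL' LG' H' kL'.
  have H'' : has_index G L' (Q * q) by rewrite mulnC.
  exists (part Q G L').
    apply/csls_of_indexP; split; last exact: has_index_part H'.
    rewrite -(primaryE sG sL' LG' pp (part_pnat _ _) _ H').
      exact: kL'.
    by rewrite -p'natE// part_pnat.
  exists (part q G L'); last exact: part_setI.
  have coQ : coprime Q q by rewrite coprime_sym.
  have HQ := has_index_part sG sL' LG' coQ H''.
  apply/csls_of_indexP; split=> //; apply: (IH Q QN) HQ _.
  - exact: subgroup_part.
  - exact: part_subset.
  by move=> r; apply: primary_part_csl H'' kL'.
have [key _] := csl_count_coprime lG q0 Q0 co.
have [|PZ _] := key.
  move=> L' /csls_of_indexP[kL' H']; have [sL' LG'] := is_csl_subgroup lG kL'.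
  by apply: split => // r pr; apply: closed.
have : csls_of_index G (q * Q) L by rewrite -PZ; apply: split => //; rewrite qQ.
by case/csls_of_indexP.
Qed.

Lemma multiplicative_primary_closed :
  multiplicative (csl_count G) <-> primary_closed.
Proof.
split=> [mult L p kL pp|closed m n m0 n0 co].
  have [sL LG] := is_csl_subgroup lG kL; have [N H] := is_csl_has_index kL.
  have N0 := has_index_gt0 (subgroup0 sG) H.
  have q0 : (0 < N`_p)%N by exact: part_gt0.
  have Q0 : (0 < N`_p^')%N by exact: part_gt0.
  have co : coprime N`_p N`_p^' by exact: coprime_partC.
  rewrite -(partnC p N0) in H.
  rewrite (primaryE sG sL LG pp (part_pnat _ _) _ H) -?p'natE ?part_pnat//.
  have [_ /(_ (mult _ _ q0 Q0 co))/(_ L)] := csl_count_coprime lG q0 Q0 co.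
  by case/(_ _)/csls_of_indexP => //; apply/csls_of_indexP.
have [key _] := csl_count_coprime lG m0 n0 co.
have [|//] := key.
move=> L /csls_of_indexP[kL H]; have [sL LG] := is_csl_subgroup lG kL.
have kp q : prime q -> is_csl G (primary q G L) by apply: closed.
have con : coprime n m by rewrite coprime_sym.
have H' : has_index G L (n * m) by rewrite mulnC.
have Hm := has_index_part sG sL LG co H.
have Hn := has_index_part sG sL LG con H'.
exists (part n G L); last exists (part m G L); last exact: part_setI.
  apply/csls_of_indexP; split=> //; apply: csl_of_primaries Hm _ => //.
  - exact: subgroup_part.
  - exact: part_subset.
  by move=> q; apply: primary_part_csl H kp.
apply/csls_of_indexP; split=> //; apply: csl_of_primaries Hn _ => //.
- exact: subgroup_part.
- exact: part_subset.
by move=> q; apply: primary_part_csl H' kp.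
Qed.

(** * Existence and uniqueness of decompositions *)

Definition finite_index_subgroup L : Prop :=
  [/\ subgroup L, L `<=` G & finite_index G L].

Lemma is_csl_finite_index L : is_csl G L -> finite_index_subgroup L.
Proof.
move=> kL; have [sL LG] := is_csl_subgroup lG kL; split=> //.
by case: kL => A [_ fA] ->.
Qed.

Lemma primary_constituent k (M : 'I_k -> set 'cV[R]_d) L q :
  prime_power_decomposition G L M -> (forall i, finite_index_subgroup (M i)) ->
  prime q -> primary q G L = G \/ exists i, primary q G L = M i.
Proof.
move=> [_ -> [p [a [p_inj pa]]]] fM pq.
have pp i : prime (p i) by case: (pa i).
have sM i : subgroup (M i) by case: (fM i).
have MG i : M i `<=` G by case: (fM i).
have H i : has_index G (M i) (p i ^ a i) by split; [case: (fM i)|case: (pa i)].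
have [[i e]|np] := pselect (exists i, p i = q).
  by right; exists i; rewrite -e (primary_bigcap_constituent sG sM MG pp p_inj H).
left; apply: (primary_bigcap_trivial sG sM MG pp H) => // i.
by apply/eqP => e; apply: np; exists i.
Qed.

(** The right-hand side mentions only [L], which makes any two decompositions of [L] have the same
    nontrivial members. *)
Lemma mem_constituents k (M : 'I_k -> set 'cV[R]_d) L N :
  prime_power_decomposition G L M -> (forall i, finite_index_subgroup (M i)) ->
  N \in [seq N <- codom M | N != G] <->
    N != G /\ exists2 q, prime q & N = primary q G L.
Proof.
move=> dec fM; rewrite mem_filter; split=> [/andP[NG /codomP[i eN]]|].
  split=> //; case: dec => [_ -> [p [a [p_inj pa]]]].
  have pp j : prime (p j) by case: (pa j).
  exists (p i); rewrite // eN (primary_bigcap_constituent (a := a))//.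
  - by move=> j; case: (fM j).
  - by move=> j; case: (fM j).
  - by move=> j; split; [case: (fM j)|case: (pa j)].
move=> [NG [q pq eN]]; rewrite NG /=.
have [e|[i e]] := primary_constituent dec fM pq.
  by rewrite eN e eqxx in NG.
by rewrite eN e codom_f.
Qed.

(** A lattice occurring at two positions has an index that is a power of two distinct primes, hence
    equals [G]. This excludes multiplicities, which [perm_eq] would detect. *)
Lemma uniq_constituents k (M : 'I_k -> set 'cV[R]_d) L :
  prime_power_decomposition G L M -> (forall i, finite_index_subgroup (M i)) ->
  uniq [seq N <- codom M | N != G].
Proof.
move=> [_ _ [p [a [p_inj pa]]]] fM.
rewrite codomE filter_map map_inj_in_uniq; first exact/filter_uniq/enum_uniq.
move=> i j.
rewrite !mem_filter /= => /andP[/eqP nG _] _ e.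
have [sM MG fin] := fM i.
have [pi ei] := pa i; have [pj ej] := pa j.
apply/eqP/negPn/negP => nij; apply: nG; apply/seteqP; split=> // x Gx.
apply: (subgroup_coprime sM (m := p i ^ a i) (n := p j ^ a j)).
- rewrite coprimeXl// coprimeXr// prime_coprime// dvdn_prime2//.
  by apply: contra nij => /eqP/p_inj/eqP.
- by rewrite -ei; apply: has_index_mulrn Gx.
- by rewrite -ej -e; apply: has_index_mulrn Gx.
Qed.

Lemma prime_power_decomposition_unique k k' (M : 'I_k -> set 'cV[R]_d)
    (M' : 'I_k' -> set 'cV[R]_d) L :
  prime_power_decomposition G L M -> prime_power_decomposition G L M' ->
  (forall i, finite_index_subgroup (M i)) ->
  (forall i, finite_index_subgroup (M' i)) -> same_constituents G M M'.
Proof.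
move=> dM dM' fM fM'; apply: uniq_perm.
- exact: uniq_constituents dM fM.
- exact: uniq_constituents dM' fM'.
by move=> N; apply/idP/idP => /mem_constituents H;
  apply/(mem_constituents N) => //; [exact: dM'|exact/H|exact: dM|exact/H].
Qed.

Lemma prime_power_decomposition_exists L : finite_index_subgroup L ->
  exists k (p : 'I_k -> nat), (forall i, prime (p i)) /\
    prime_power_decomposition G L (fun i => primary (p i) G L).
Proof.
move=> [sL LG fL]; have H : has_index G L (sub_index G L) by [].
have [k [p [k0 p_inj pp e]]] := primary_decomposition_exists sG sL LG H.
exists k, p; split=> //; split=> //.
exists p, (fun i => logn (p i) (sub_index G L)); split=> // i; split=> //.
by have [] := has_index_primary sG sL LG (pp i) H.
Qed.

Lemma decompose_primary_closed :
  csls_decompose_uniquely G <-> primary_closed.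
Proof.
split=> [dec L p [A cA ->] pp|closed A cA].
  have [[k [B [cB dB]]] _] := dec A cA.
  have fB i : finite_index_subgroup (csl G (B i)).
    by apply: is_csl_finite_index; exists (B i).
  have [->|[i ->]] := primary_constituent dB fB pp; first exact: is_csl_self.
  by exists (B i).
have kA : is_csl G (csl G A) by exists A.
split=> [|k k' B B' [cB dB] [cB' dB']]; last first.
  by apply: prime_power_decomposition_unique dB dB' _ _ => i;
    apply: is_csl_finite_index; [exists (B i)|exists (B' i)].
have [k [p [pp dec]]] := prime_power_decomposition_exists (is_csl_finite_index kA).
have /choice[B BP] : forall i, exists B, coincidence_isometry G B /\
    primary (p i) G (csl G A) = csl G B.
  by move=> i; have [B cB e] := closed _ _ kA (pp i); exists B.
exists k, B; split=> [i|]; first by case: (BP i).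
suff <- : (fun i => primary (p i) G (csl G A)) = (fun i => csl G (B i)) by [].
by apply/funext => i; case: (BP i).
Qed.

(** * Multiple CSLs *)

Lemma mcslE n (A : 'I_n -> 'M[R]_d) : (0 < n)%N ->
  mcsl G A = \bigcap_i csl G (A i).
Proof.
move=> n0; apply/seteqP; split=> [x [Gx Ax] i _|x Ax].
  by split=> //; apply: Ax.
by split=> [|i _]; [case: (Ax (Ordinal n0) Logic.I)|case: (Ax i Logic.I)].
Qed.

(** With [N] the product of the single indices, the intersection contains [NG], of finite index
    [N ^ d]. *)
Lemma is_mcsl_finite_index n L : is_mcsl G n L -> finite_index_subgroup L.
Proof.
move=> [n0 [A cA ->]]; rewrite mcslE//.
have kA i : is_csl G (csl G (A i)) by exists (A i).
have sA i : subgroup (csl G (A i)) by exact: subgroup_csl.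
have sI : subgroup (\bigcap_i csl G (A i)).
  split; first by move=> i _; apply: subgroup0.
  by move=> x y Lx Ly i _; apply: subgroupB; [exact: sA|exact: Lx|exact: Ly].
have IG : \bigcap_i csl G (A i) `<=` G.
  by move=> x /(_ (Ordinal n0) Logic.I) [].
split=> //.
have /choice[q qP] : forall i, exists q, has_index G (csl G (A i)) q.
  by move=> i; apply: is_csl_has_index.
pose N := (\prod_i q i)%N.
have N0 : (0 < N)%N.
  by apply: prodn_gt0 => i; apply: has_index_gt0 (qP i); apply: subgroup0.
have sNG : subgroup [set x *+ N | x in G] by exact: subgroup_muln.
have sub : [set x *+ N | x in G] `<=` \bigcap_i csl G (A i).
  move=> _ [x Gx <-]; apply: (bigcap_mulrn_prod (P := xpredT) sG) => //.
  by move=> i; apply: subIsetl.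
by have [a [b [[]]]] := has_index_factor sG sNG sI sub IG (has_index_muln lG N0).
Qed.

Lemma is_mcsl1 L : is_mcsl G 1 L -> is_csl G L.
Proof.
move=> [_ [A cA ->]]; exists (A ord0) => //; rewrite mcslE//.
apply/seteqP; split=> [x /(_ ord0 Logic.I)//|x Lx i _].
by rewrite (ord1 i).
Qed.

(** A CSL is an MCSL of order 1, and so are its constituents. Conversely, primary parts commute with
    intersections, so those of an MCSL of order [n] again have order [n]. *)
Lemma mcsl_decompose_primary_closed :
  mcsls_decompose_uniquely G <-> primary_closed.
Proof.
split=> [dec L p [A cA ->] pp|closed n L n1 mL].
  have mA : is_mcsl G 1 (csl G A).
    split=> //; exists (fun=> A) => //; rewrite mcslE//.
    by apply/seteqP; split=> [x Lx i _//|x /(_ ord0 Logic.I)].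
  have [[k [M [mM dM]]] _] := dec 1%N _ isT mA.
  have fM i : finite_index_subgroup (M i).
    by have [q _ /is_mcsl_finite_index] := mM i.
  have [->|[i ->]] := primary_constituent dM fM pp; first exact: is_csl_self.
  (* Order 0 is excluded by [is_mcsl], and orders above 1 by the bound [q <= 1]. *)
  by have [[|[|//]]] := mM i; [move=> _ []|move=> _ /is_mcsl1].
split=> [|k k' M M' [mM dM] [mM' dM']]; last first.
  apply: prime_power_decomposition_unique dM dM' _ _ => i.
    by have [q _ /is_mcsl_finite_index] := mM i.
  by have [q _ /is_mcsl_finite_index] := mM' i.
have [k [p [pp dec]]] := prime_power_decomposition_exists (is_mcsl_finite_index mL).
exists k, (fun i => primary (p i) G L); split=> // j; exists n => //.
split=> //; case: mL => _ [A cA ->]; rewrite mcslE//.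
rewrite primary_bigcap//; last by move=> i; apply: subgroup_csl.
have /choice[B BP] : forall i, exists B, coincidence_isometry G B /\
    primary (p j) G (csl G (A i)) = csl G B.
  have kA i : is_csl G (csl G (A i)) by exists (A i).
  by move=> i; have [B cB e] := closed _ _ (kA i) (pp j); exists B.
exists B => [i|]; first by case: (BP i).
by rewrite mcslE//; apply: eq_bigcapr => i _; case: (BP i).
Qed.

End Multiplicativity.

Theorem theorem7 (R : realType) (d : nat) (G : set 'cV[R]_d)
    (hG : is_lattice G) :
  (multiplicative (csl_count G) <-> csls_decompose_uniquely G) /\
  (csls_decompose_uniquely G <-> mcsls_decompose_uniquely G).
Proof.
have e1 := multiplicative_primary_closed hG.
have e2 := decompose_primary_closed hG.
have e3 := mcsl_decompose_primary_closed hG.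
split; first exact: (iff_trans e1 (iff_sym e2)).
exact: (iff_trans e2 (iff_sym e3)).
Qed.
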